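(* For every integer $n\ge 2$, during a complete run of $\mathrm{AccelDesc}(n)$, the write statements executed after initialisation are ''$d_q\leftarrow 1$'', the two occurrences of ''$d_q\leftarrow m$'', and ''$d_q\leftarrow n'$''. Together they are executed a total of exactly $p(n)+p(n-2)-2$ times.
   Context: $p(n)$ denotes the number of partitions of $n$, with $p(0)=1$. The procedure $\mathrm{AccelDesc}(n)$ (Zoghbi and Stojmenović's algorithm) operates on an array $d$ as follows and visits every descending composition of $n$ (a sequence of positive integers in nonincreasing order summing to $n$) exactly once: 1. Initialisation: $k\leftarrow1$; $q\leftarrow1$; $d_2,\dots,d_n\leftarrow 1$; $d_1\leftarrow n$; visit $\langle d_1\rangle$. 2. While $q\ne 0$: - If $d_q=2$: $k\leftarrow k+1$; $d_q\leftarrow 1$; $q\leftarrow q-1$. - Else: - $m\leftarrow d_q-1$; $n'\leftarrow k-q+1$; $d_q\leftarrow m$. - While $n'\ge m$: $q\leftarrow q+1$; $d_q\leftarrow m$; $n'\leftarrow n'-m$. - If $n'=0$: $k\leftarrow q$. - Else: $k\leftarrow q+1$; if $n'>1$ then $q\leftarrow q+1$ and $d_q\leftarrow n'$. - Visit $\langle d_1,\dots,d_k\rangle$. *)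

(* Defs.v *)
From HB Require Import structures.
From mathcomp Require Import all_boot.

Set Implicit Arguments.
Unset Strict Implicit.
Unset Printing Implicit Defensive.

Declare Scope cmd_scope.
Delimit Scope cmd_scope with cmd.

(** * Partitions *)

Definition desc_composition (n : nat) (s : seq nat) : bool :=
  [&& sorted geq s, all (leq 1) s & sumn s == n].

(** A descending composition of [n] has at most [n] parts, each at most [n]
    (see [desc_composition_bseq]), so the finite type [n.-bseq 'I_n.+1]
    contains each of them exactly once. *)
Definition npart (n : nat) : nat :=
  #|[set s : n.-bseq 'I_n.+1 | desc_composition n (map val s)]|.

Lemma desc_composition_bseq (n : nat) (s : seq nat) :
  desc_composition n s -> exists b : n.-bseq 'I_n.+1, map val b = s.
Proof.
case/and3P=> _ s_gt0 /eqP sum_s.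
have size_s : size s <= n.
  rewrite -{}sum_s; elim: s s_gt0 => //= x s IHs /andP[x_gt0 /IHs].
  by rewrite -add1n => /(leq_add x_gt0).
have le_s x : x \in s -> x < n.+1.
  rewrite ltnS -{}sum_s; elim: s {s_gt0 size_s} => //= y s IHs.
  rewrite inE => /predU1P[->|/IHs le_x]; first exact: leq_addr.
  exact: leq_trans le_x (leq_addl _ _).
have size_b : size (map (@inord n) s) <= n by rewrite size_map.
exists (Bseq size_b); rewrite /= -map_comp -[RHS]map_id.
by apply/eq_in_map=> x /le_s lt_x; rewrite /= inordK.
Qed.

(** * A small imperative language *)

(** The array [d] is indexed from 1.  The last two fields only observe the
    run: [writes] is the number of writes to [d] since initialisation, and
    [visited] lists the visited sequences in order. *)
Record state : Type := State {
  st_d : nat -> nat;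
  st_k : nat;
  st_q : nat;
  st_m : nat;
  st_n' : nat;
  writes : nat;
  visited : seq (seq nat)
}.

(** [c s t]: command [c] run from [s] terminates in [t]. *)
Definition cmd : Type := state -> state -> Prop.

Definition skip : cmd := fun s t => t = s.

Definition seqc (c1 c2 : cmd) : cmd :=
  fun s t => exists2 u, c1 s u & c2 u t.

Definition ifc (b : state -> bool) (c1 c2 : cmd) : cmd :=
  fun s t => if b s then c1 s t else c2 s t.

Inductive whilec (b : state -> bool) (c : cmd) : cmd :=
| while_stop s : ~~ b s -> whilec b c s s
| while_step s u t : b s -> c s u -> whilec b c u t -> whilec b c s t.

Definition set_k (e : state -> nat) : cmd := fun s t =>
  t = State (st_d s) (e s) (st_q s) (st_m s) (st_n' s) (writes s) (visited s).

Definition set_q (e : state -> nat) : cmd := fun s t =>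
  t = State (st_d s) (st_k s) (e s) (st_m s) (st_n' s) (writes s) (visited s).

Definition set_m (e : state -> nat) : cmd := fun s t =>
  t = State (st_d s) (st_k s) (st_q s) (e s) (st_n' s) (writes s) (visited s).

Definition set_n' (e : state -> nat) : cmd := fun s t =>
  t = State (st_d s) (st_k s) (st_q s) (st_m s) (e s) (writes s) (visited s).

(** The write statement [d_q <- e], the only command that modifies [d]. *)
Definition write_dq (e : state -> nat) : cmd := fun s t =>
  t = State [eta st_d s with st_q s |-> e s]
        (st_k s) (st_q s) (st_m s) (st_n' s) (writes s).+1 (visited s).

Definition visit : cmd := fun s t =>
  t = State (st_d s) (st_k s) (st_q s) (st_m s) (st_n' s) (writes s)
        (rcons (visited s) [seq st_d s i | i <- iota 1 (st_k s)]).

Notation "c1 ;; c2" := (seqc c1 c2)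
  (at level 90, right associativity) : cmd_scope.

(** * Zoghbi and Stojmenovic's algorithm *)

Section AccelDesc.

Local Open Scope cmd_scope.

(** The values of [m] and [n'] are irrelevant here, and so is [d] outside of
    the indices [1..n]. *)
Definition accel_desc_init (n : nat) : state :=
  State (fun i => if i == 1 then n else if 2 <= i <= n then 1 else 0)
    1 1 0 0 0 [:: [:: n]].

(** For [n >= 2] the reachable states satisfy [q <= k], with [0 < q] and
    [d_q >= 2] whenever the body is entered, so that no subtraction below is
    truncated. *)
Definition accel_desc_body : cmd :=
  ifc (fun s => st_d s (st_q s) == 2)
    (set_k (fun s => st_k s + 1) ;;
     write_dq (fun=> 1) ;;
     set_q (fun s => st_q s - 1))
    (set_m (fun s => st_d s (st_q s) - 1) ;;
     set_n' (fun s => st_k s - st_q s + 1) ;;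
     write_dq st_m ;;
     whilec (fun s => st_n' s >= st_m s)
       (set_q (fun s => st_q s + 1) ;;
        write_dq st_m ;;
        set_n' (fun s => st_n' s - st_m s)) ;;
     ifc (fun s => st_n' s == 0)
       (set_k st_q)
       (set_k (fun s => st_q s + 1) ;;
        ifc (fun s => st_n' s > 1)
          (set_q (fun s => st_q s + 1) ;;
           write_dq st_n')
          skip)) ;;
  visit.

(** [accel_desc n t]: a complete run of AccelDesc(n) terminates in [t]. *)
Definition accel_desc (n : nat) (t : state) : Prop :=
  whilec (fun s => st_q s != 0) accel_desc_body (accel_desc_init n) t.

End AccelDesc.

(* Main.v *)
Require Import Defs.
From mathcomp Require Import all_boot.
From mathcomp Require Import zify.

(** Call the array filled with parts [m] above [q0] when its suffix after index
    [q0] is the greedy partition of [n] into parts at most [m].  From such a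
    state the algorithm runs through all partitions of [n] into parts at most
    [m] on that suffix and returns to [q = q0]: it first exhausts the tail of
    sum [n - m] after the leading [m], then lowers this [m], which either
    refills the suffix with parts [m - 1] or, for [m = 2], leaves only ones.
    This is the recursion p_m(n) = p_m(n - m) + p_(m-1)(n), which also holds for
    partitions of [n - 2]; by induction the number of writes, counting those
    that fill the suffix, is p_m(n) + p_m(n - 2) - 1.  At the start [m = n] and
    the filling write belongs to the initialisation. *)

(** * Partitions with bounded parts and their recursion *)

(** The recursion is lexicographic in the bound and the sum, hence the nested [fix]; [n' - m']
    equals [n - m] in a form that is structurally smaller than [n]. *)
Fixpoint bounded_descs (m : nat) : nat -> seq (seq nat) :=
  if m is m'.+1 then
    fix descs_m (n : nat) : seq (seq nat) :=
      bounded_descs m' n ++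
      (if n is n'.+1 then
         if m' <= n' then map (cons m) (descs_m (n' - m')) else [::]
       else [::])
  else fun n => if n == 0 then [:: [::]] else [::].

Arguments bounded_descs : simpl never.

Lemma bounded_descsS m n :
  bounded_descs m.+1 n = bounded_descs m n ++
    (if m < n then map (cons m.+1) (bounded_descs m.+1 (n - m.+1)) else [::]).
Proof. by case: n => [|n]; rewrite ?ltn0. Qed.

Lemma mem_bounded_descs m n s :
  (s \in bounded_descs m n) =
  [&& sorted geq s, all (fun x => 0 < x <= m) s & sumn s == n].
Proof.
elim: m n s => [|m IHm] n s.
  rewrite /bounded_descs; case: s => [|x s] /=; first by case: n.
  have -> : 0 < x <= 0 = false by lia.
  by rewrite andbF; case: n.
elim/ltn_ind: n s => n IHn s; rewrite bounded_descsS mem_cat IHm.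
case: ltnP => [lt_mn | le_nm]; last first.
  (* No part exceeds the sum, so for [n <= m] the bounds [m] and [m.+1] admit the same sequences. *)
  rewrite orbF; congr (_ && _); apply/andP/andP=> -[ran_s /eqP sum_s]; split=> //.
  - by apply: sub_all ran_s => x; lia.
  - by rewrite sum_s.
  - apply/allP=> x s_x; move/allP/(_ x s_x): (ran_s) => /andP[-> _] /=.
    rewrite (leq_trans _ le_nm) // -sum_s.
    elim: s s_x {ran_s sum_s} => //= y s IHs.
    rewrite inE => /predU1P[->|/IHs]; lia.
  - by rewrite sum_s.
case: s => [|x s] /=.
  by rewrite [X in _ || X](_ : _ = false) ?orbF //; apply/mapP=> -[].
have [->|neq_x] := eqVneq x m.+1.
  rewrite ltnn andbF /= mem_map => [|? ? []] //.
  rewrite IHn; last by lia.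
  have -> : (m.+1 + sumn s == n) = (sumn s == n - m.+1) by lia.
  rewrite (path_sortedE (rev_trans leq_trans)) leqnn /=.
  have [ran_s|] := boolP (all (fun x => 0 < x <= m.+1) s); rewrite ?andbF //=.
  have -> // : all (geq m.+1) s.
  by apply: sub_all ran_s => y; case/andP.
have -> : (x :: s \in map (cons m.+1) (bounded_descs m.+1 (n - m.+1))) = false.
  by apply/mapP=> -[u _ [eq_x _]]; rewrite eq_x eqxx in neq_x.
rewrite orbF (path_sortedE (rev_trans leq_trans)).
have -> : (x <= m.+1) = (x <= m) by lia.
have [le_xm|] := leqP x m; rewrite ?andbF //= -!andbA.
have [le_s|] //= := boolP (all (geq x) s); congr [&& _, _, _ & _].
by apply: eq_in_all => y /(allP le_s) /=; lia.
Qed.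

(** The two blocks of the recursion are disjoint: a sequence headed by [m.+1] violates the bound
    [m]. *)
Lemma bounded_descs_uniq m n : uniq (bounded_descs m n).
Proof.
elim: m n => [|m IHm] n; first by rewrite /=; case: n.
elim/ltn_ind: n => n IHn; rewrite bounded_descsS cat_uniq IHm /=.
case: ifP => //= lt_mn; rewrite map_inj_uniq => [|? ? []] //.
rewrite IHn ?andbT; last by lia.
apply/hasPn=> _ /mapP[s _ ->]; rewrite mem_bounded_descs /=.
by rewrite ltnn !andbF.
Qed.

Definition nbounded (m n : nat) : nat := size (bounded_descs m n).

Lemma nboundedS m n : nbounded m.+1 n =
  nbounded m n + (if m < n then nbounded m.+1 (n - m.+1) else 0).
Proof.
rewrite /nbounded bounded_descsS size_cat.
by case: ifP => _; rewrite ?size_map.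
Qed.

Lemma nbounded_le m n : n <= m -> nbounded m n = nbounded n n.
Proof.
move=> le_nm; rewrite -(subnKC le_nm); elim: (m - n) => [|k IHk].
  by rewrite addn0.
by rewrite addnS nboundedS ifF ?addn0 //; lia.
Qed.

Lemma nbounded_1n n : nbounded 1 n = 1.
Proof.
elim: n => // n IHn; rewrite nboundedS ltnS leq0n subSS subn0 IHn.
by rewrite /nbounded.
Qed.

Lemma npart_bounded n : npart n = nbounded n n.
Proof.
rewrite /npart cardE -(size_map (fun s : n.-bseq 'I_n.+1 => map val s)).
apply/perm_size/uniq_perm; last move=> s.
- rewrite map_inj_uniq ?enum_uniq // => u v eq_uv.
  by apply/val_inj/(inj_map val_inj).
- exact: bounded_descs_uniq.
rewrite mem_bounded_descs; apply/mapP/and3P=> [[b]|[sort_s ran_s sum_s]].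
  rewrite mem_enum inE => /and3P[sort_b gt0_b sum_b] ->; split=> //.
  rewrite all_map; apply/allP=> i b_i /=; rewrite leq_ord andbT.
  by move/allP: gt0_b; apply; apply: map_f.
have desc_s : desc_composition n s.
  by rewrite /desc_composition sort_s sum_s andbT; apply: sub_all ran_s => x /andP[].
have [b def_s] := desc_composition_bseq desc_s.
by exists b; rewrite // mem_enum inE def_s.
Qed.

(** For [n < 2] the truncated [nbounded m (n - 2)] would give 1 instead of 0 and break the
    recursion. *)
Definition nbounded_sub2 (m n : nat) : nat :=
  if n is n'.+2 then nbounded m n' else 0.

Lemma nbounded_sub2S m n : m < n ->
  nbounded_sub2 m.+1 n = nbounded_sub2 m n + nbounded_sub2 m.+1 (n - m.+1).
Proof.
case: n => [|[|n]] //= lt_mn.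
rewrite nboundedS; case: ifP => [lt_m_n|ge_m_n].
  by have -> : n.+2 - m.+1 = (n - m.+1).+2 by lia.
by case def_k: (n.+2 - m.+1) => [|[|k]] //; lia.
Qed.

(** * Determinism and composition of runs *)

(** Determinism transfers the count from one exhibited run to every complete run. *)
Definition functional (c : cmd) := forall s t u, c s t -> c s u -> t = u.

Lemma functional_assign (f : state -> state) : functional (fun s t => t = f s).
Proof. by move=> s t u -> ->. Qed.

Lemma functional_seqc c1 c2 :
  functional c1 -> functional c2 -> functional (seqc c1 c2).
Proof.
move=> f1 f2 s t u [s1 st1 st] [s2 st2 su].
by apply: f2 st _; rewrite (f1 _ _ _ st1 st2).
Qed.

Lemma functional_ifc b c1 c2 :
  functional c1 -> functional c2 -> functional (ifc b c1 c2).
Proof. by move=> f1 f2 s t u; rewrite /ifc; case: ifP => _; [apply: f1 | apply: f2]. Qed.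

Lemma functional_whilec b c : functional c -> functional (whilec b c).
Proof.
move=> fc s t u st; elim: st u => {s t} [s b's|s s1 t b_s c_s _ IHt] u su.
  by case: su b's => // s' u' u'' ->.
case: su b_s c_s => [s' /negPf-> //|s' s2 u' _ c_s2 s2u _ c_s1].
by apply: IHt; rewrite (fc _ _ _ c_s1 c_s2).
Qed.

Lemma functional_body : functional accel_desc_body.
Proof.
by repeat first [exact: functional_assign | apply: functional_seqc
                | apply: functional_ifc | apply: functional_whilec].
Qed.

(* Stated on complete runs rather than as a transition closure, since [whilec]
   is a big-step relation. *)
Definition reach (s t : state) : Prop := forall u,
  whilec (fun s => st_q s != 0) accel_desc_body t u ->
  whilec (fun s => st_q s != 0) accel_desc_body s u.

Lemma reach_step s t : 0 < st_q s -> accel_desc_body s t -> reach s t.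
Proof.
by move=> q_gt0 st u tu; apply: while_step st tu; rewrite -lt0n.
Qed.

(** * Passes through the loop body and the cost of draining a filled suffix *)

Lemma divn_sub n m : 0 < m -> m <= n -> n %/ m = ((n - m) %/ m).+1.
Proof. by move=> m_gt0 le_mn; rewrite -{1}(subnKC le_mn) -{1}[m]mul1n divnMDl. Qed.

Lemma modn_sub n m : m <= n -> n %% m = (n - m) %% m.
Proof. by move=> le_mn; rewrite -{1}(subnKC le_mn) modnDl. Qed.

(** Each pass stores one [m] and subtracts it from [n'], so the loop performs Euclidean division. *)
Lemma fill_loop s : 0 < st_m s -> exists t,
  whilec (fun s => st_n' s >= st_m s)
       (seqc (set_q (fun s => st_q s + 1)) (seqc
        (write_dq st_m)
        (set_n' (fun s => st_n' s - st_m s)))) s t /\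
  [/\ st_k t = st_k s, st_q t = st_q s + st_n' s %/ st_m s,
      st_n' t = st_n' s %% st_m s,
      writes t = writes s + st_n' s %/ st_m s &
      forall i, st_d t i =
        if st_q s < i <= st_q s + st_n' s %/ st_m s then st_m s else st_d s i].
Proof.
case: s => d k q m n' w v /= m_gt0.
elim/ltn_ind: n' d q w => n' IHn d q w; case: (leqP m n') => [le_mn|lt_nm].
  have [|t [run [eq_k eq_q eq_n eq_w eq_d]]] :=
    IHn (n' - m) _ [eta d with q + 1 |-> m] (q + 1) w.+1; first by lia.
  exists t; split.
    apply: while_step run => //.
    by eexists; [reflexivity | eexists; reflexivity].
  rewrite (divn_sub _ _ m_gt0 le_mn) (modn_sub _ _ le_mn).
  move: {eq_q eq_w eq_d}(_ %/ m) eq_q eq_w eq_d => x eq_q eq_w eq_d.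
  rewrite eq_k eq_q eq_n eq_w; split=> //; try lia.
  move=> i; rewrite eq_d /=.
  have [->|neq_i] := eqVneq i (q + 1).
    by rewrite ltnn /= ifT //; lia.
  by congr (if _ then _ else _); lia.
exists (State d k q m n' w v); split; first by apply: while_stop; rewrite -ltnNge.
rewrite /= divn_small // modn_small // !addn0; split=> // i.
by rewrite ifF //; lia.
Qed.

(* A final part [1] is not stored through [q]: the array already holds ones
   there, hence the two different thresholds on the remainder. *)
Definition filled (q0 m n : nat) (s : state) : Prop :=
  [/\ forall i, q0 < i <= q0 + n %/ m -> st_d s i = m,
      1 < n %% m -> st_d s (q0 + n %/ m).+1 = n %% m,
      st_q s = q0 + n %/ m + (1 < n %% m) &
      st_k s = q0 + n %/ m + (0 < n %% m)].

(** The part [m.+1] and the [r] units after it are redistributed greedily into parts [m]. The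
    quotient also counts the write that lowers [m.+1] in place. *)
Lemma body_refill q0 m r s : 1 < m ->
    st_d s q0.+1 = m.+1 -> st_q s = q0.+1 -> st_k s = q0.+1 + r ->
  exists t, [/\ accel_desc_body s t, filled q0 m (m.+1 + r) t,
    forall i, i <= q0 -> st_d t i = st_d s i &
    writes t = writes s + (m.+1 + r) %/ m + (1 < (m.+1 + r) %% m)].
Proof.
case: s => d k q m0 n0 w v /= m_gt1 def_d -> ->.
have m_gt0 : 0 < m by lia.
have [|t] := @fill_loop (State [eta d with q0.+1 |-> m] (q0.+1 + r) q0.+1 m
  r.+1 w.+1 v); first by [].
case: t => d1 k1 q1 m1 n1 w1 v1 /= [run [def_k1 def_q1 def_n1 def_w1 def_d1]].
have le_mN : m <= m.+1 + r by lia.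
have defN : m.+1 + r - m = r.+1 by lia.
rewrite /filled (divn_sub _ _ m_gt0 le_mN) (modn_sub _ _ le_mN) defN.
move: (r.+1 %/ m) (r.+1 %% m) def_q1 def_n1 def_w1 def_d1.
move=> a b def_q1 def_n1 def_w1 def_d1.
(* The prefix of the body common to all three cases of the remainder, which differ only in the final
   conditional. *)
have body u : ifc (fun s => st_n' s == 0) (set_k st_q)
     (seqc (set_k (fun s => st_q s + 1))
       (ifc (fun s => st_n' s > 1)
         (seqc (set_q (fun s => st_q s + 1)) (write_dq st_n')) skip))
     (State d1 k1 q1 m1 n1 w1 v1) u ->
   exists2 t, visit u t & accel_desc_body (State d (q0.+1 + r) q0.+1 m0 n0 w v) t.
  move=> fin; eexists; first by reflexivity.
  eexists; last by reflexivity.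
  rewrite /ifc /= def_d ifF; last by lia.
  eexists; first by reflexivity.
  eexists; first by reflexivity.
  eexists; first by reflexivity.
  rewrite /= def_d subSS subn0.
  have -> : q0.+1 + r - q0.+1 + 1 = r.+1 by lia.
  by eexists; first exact: run.
have d1_m i : q0 < i <= q0 + a.+1 -> d1 i = m.
  move=> ran_i; rewrite def_d1 /=; case: ifP => // out_i.
  by rewrite ifT //; lia.
have d1_d i : i <= q0 -> d1 i = d i.
  by move=> le_i; rewrite def_d1 /= !ifF //; lia.
have [n1_0|n1_neq0] := eqVneq n1 0.
  have [|t -> body_t] := body (State d1 q1 q1 m1 n1 w1 v1).
    by rewrite /ifc /= n1_0.
  eexists; split; first exact: body_t; rewrite /= -?def_n1 ?n1_0 //=; last lia.
  by split=> //=; lia.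
have n1_gt0 : 0 < n1 by rewrite lt0n.
have [n1_gt1|n1_le1] := ltnP 1 n1.
  have [|t -> body_t] :=
    body (State [eta d1 with q1 + 1 |-> n1] (q1 + 1) (q1 + 1) m1 n1 w1.+1 v1).
    rewrite /ifc /= (negPf n1_neq0); eexists; first by reflexivity.
    by rewrite /= n1_gt1; eexists; reflexivity.
  eexists; split; first exact: body_t; rewrite /= -?def_n1 ?n1_gt1 /=.
  - split=> /= [i ran_i|_||]; [|by rewrite ifT //; lia|lia|lia].
    by rewrite ifF ?d1_m //; lia.
  - by move=> i le_i; rewrite ifF ?d1_d //; lia.
  - lia.
have [|t -> body_t] := body (State d1 (q1 + 1) q1 m1 n1 w1 v1).
  rewrite /ifc /= (negPf n1_neq0); eexists; first by reflexivity.
  by rewrite /= ltnNge n1_le1.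
eexists; split; first exact: body_t; rewrite /= -?def_n1 //=; last lia.
by split=> //=; lia.
Qed.

(** A 2 splits into two ones: one more part for a single write, and nothing to refill. *)
Lemma body_pop2 q0 r s :
    st_d s q0.+1 = 2 -> st_q s = q0.+1 -> st_k s = q0.+1 + r ->
  exists t, [/\ accel_desc_body s t, st_q t = q0, st_k t = q0 + r.+2,
    forall i, i <= q0 -> st_d t i = st_d s i & writes t = (writes s).+1].
Proof.
case: s => d k q m n' w v /= def_d -> ->.
eexists; split.
- eexists; last by reflexivity.
  rewrite /ifc /= def_d /=; eexists; first by reflexivity.
  by eexists; reflexivity.
- by rewrite /= subn1.
- by rewrite /=; lia.
- by move=> i le_i /=; rewrite ifF //; lia.
- by [].
Qed.

(* The writes that fill the suffix, [n %/ m + (1 < n %% m)], stand on the left so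
   that the cost of refilling with smaller parts cancels in the induction. *)
Lemma filled_drain m n q0 s : 1 < m -> filled q0 m n s ->
  exists t, [/\ reach s t, st_q t = q0, st_k t = q0 + n,
    forall i, i <= q0 -> st_d t i = st_d s i &
    writes t + n %/ m + (1 < n %% m) + 1 =
      writes s + nbounded m n + nbounded_sub2 m n].
Proof.
elim/ltn_ind: m n q0 s => m IHm n; elim/ltn_ind: n => n IHn q0 s m_gt1 fill_s.
have m_gt0 : 0 < m by lia.
have [lt_nm|le_mn] := ltnP n m.
  have [n_gt1|n_le1] := ltnP 1 n.
    (* For [1 < n < m] the greedy filling is the single part [n], which is also the filling with the
       smaller bound [n]. *)
    have [||t [st q_t k_t d_t w_t]] := IHm n lt_nm n q0 s; first by [].
      case: fill_s; rewrite /filled (divn_small lt_nm) (modn_small lt_nm) n_gt1 divnn modnn.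
      move=> _ def_d q_s k_s; rewrite ltnW // in k_s *; split; try lia.
      move=> i ran_i; rewrite -[RHS]def_d //; congr (st_d s _); lia.
    exists t; split=> //; rewrite divn_small ?modn_small // n_gt1.
    move: w_t; rewrite divnn modnn (ltnW n_gt1).
    rewrite (nbounded_le m n) ?(ltnW lt_nm) //.
    have -> : nbounded_sub2 m n = nbounded_sub2 n n.
      case: (n) lt_nm => [|[|n']] //= lt_nm.
      by rewrite (nbounded_le m) ?(nbounded_le n'.+2) //; lia.
    lia.
  (* For [n <= 1] nothing is stored through [q], so [q] is already [q0] and the empty run
     suffices. *)
  exists s; case: fill_s; rewrite divn_small // modn_small //.
  rewrite ltnNge n_le1 /= !addn0 => _ _ q_s k_s; split=> //.
    by rewrite k_s; lia.
  have -> : nbounded m n = 1.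
    by rewrite nbounded_le ?(ltnW lt_nm) //; case: (n) n_le1 => [|[|]].
  by case: (n) n_le1 => [|[|]] // _; rewrite addn0.
case: fill_s; rewrite (divn_sub _ _ m_gt0 le_mn) (modn_sub _ _ le_mn).
move=> d_s d_rem q_s k_s.
have [||t [st q_t k_t d_t w_t]] := IHn (n - m) _ q0.+1 s m_gt1.
- lia.
- rewrite /filled !addSnnS.
  split=> // i ran_i; apply: d_s; case/andP: ran_i => lt_i ->.
  by rewrite ltnW.
have d_top : st_d t q0.+1 = m.
  by rewrite d_t // d_s // ltnS leqnn -addn1 leq_add2l.
have q_gt0 : 0 < st_q t by rewrite q_t.
have d_below i : i <= q0 -> st_d t i = st_d s i by move=> le_i; apply: d_t; lia.
case: m m_gt1 m_gt0 le_mn w_t d_top k_t {d_s d_rem q_s k_s d_t} IHm IHn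
  => [|[|[|m]]] // m_gt1 m_gt0 le_mn w_t d_top k_t IHm _.
  have [u [tu q_u k_u d_u w_u]] := body_pop2 _ _ _ d_top q_t k_t.
  exists u; split=> //.
  - by move=> v /(reach_step _ _ q_gt0 tu)/st.
  - by rewrite k_u; lia.
  - by move=> i le_i; rewrite d_u ?d_below.
  rewrite w_u nboundedS nbounded_sub2S // le_mn nbounded_1n.
  (* The partitions into ones add 1 to each count; this balances the write of the pop and the
     leading 2 of the filling. *)
  have -> : nbounded_sub2 1 n = 1.
    by case: (n) le_mn => [|[|n']] //= _; rewrite nbounded_1n.
  lia.
have [u [tu fill_u d_u w_u]] := body_refill _ m.+2 _ _ isT d_top q_t k_t.
(* The lowered part and the [n - m] units left by the drained tail again sum to [n]. *)
rewrite subnKC // in fill_u w_u.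
have [||v [uv q_v k_v d_v w_v]] := IHm m.+2 _ n q0 u _ fill_u; try by [].
exists v; split=> //.
- by move=> x /uv/(reach_step _ _ q_gt0 tu)/st.
- by move=> i le_i; rewrite d_v ?d_u ?d_below.
rewrite (nboundedS m.+2) nbounded_sub2S // le_mn.
lia.
Qed.

Theorem theorem4p16 (n : nat) (hn : 2 <= n) :
  (exists t : state, accel_desc n t) /\
  (forall t : state, accel_desc n t -> writes t = npart n + npart (n - 2) - 2).
Proof.
(* The initial array is the filling above index 0 by the single part [n], and the return to [q = 0]
   is the exit condition. *)
have [|t [run q_t _ _ w_t]] := filled_drain n n 0 (accel_desc_init n) hn.
  rewrite /filled divnn modnn ltnW //=; split=> // i ran_i.
  by rewrite ifT //; lia.
have run_t : accel_desc n t by apply/run/while_stop; rewrite q_t.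
split=> [|u run_u]; first by exists t.
rewrite -(functional_whilec _ _ functional_body _ _ _ run_t run_u).
(* The 2 subtracted is the initial part [n], not counted in [writes], plus the constant 1 of
   [filled_drain]. *)
move: w_t; rewrite divnn modnn ltnW // !npart_bounded /=.
have -> : nbounded_sub2 n n = nbounded (n - 2) (n - 2).
  by case: (n) hn => [|[|k]] // _; rewrite subn2 /= nbounded_le //; lia.
lia.
Qed.
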